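(* Let $\mathbf C_{\mathbf h}$, $\mathbf C_{\mathbf y}$, $\mathbf C_{\mathbf h\hat{\mathbf y}}$, and, for $\sigma>0$, $\mathbf C_{\tilde{\mathbf h}}(\sigma)$ and $C(\sigma)$ be as defined in the context, and let $T\ge K$ be a positive integer and $C_{\mathrm u}>0$. Consider the problem $$\min_{\sigma}\ \mathrm{tr}\big(\mathbf C_{\tilde{\mathbf h}}(\sigma)\big)\quad\text{subject to}\quad C(\sigma)\le T C_{\mathrm u}.$$ Then the solution of this problem is the $\sigma$ that satisfies the inequality constraint with equality: there is a $\sigma>0$ with $C(\sigma)=TC_{\mathrm u}$, and it attains the minimum.
   Context: Let $N,R,K$ be positive integers, $\rho_{\mathrm u}\in[0,1)$, $\sigma_{\mathrm u}^2>0$, $P_{\mathrm u}>0$. Let $\mathbf W\in\mathbb C^{N\times R}$ have unit-modulus entries, let $\mathbf X\in\mathbb C^{T\times K}$ satisfy $\mathbf X^{\mathrm H}\mathbf X=TP_{\mathrm u}\mathbf I_K$, and let $\mathbf C_{\mathbf h}\in\mathbb C^{NK\times NK}$ be a block-diagonal Hermitian nonnegative definite matrix with $K$ diagonal blocks of size $N\times N$. Put $\mathbf\Psi=\overline{\mathbf X}\otimes\mathbf W^{\mathrm H}\in\mathbb C^{RT\times NK}$ (with $\overline{\mathbf X}$ the entrywise complex conjugate), and, with $\mathrm{diag}(\mathbf A)$ the diagonal matrix having the diagonal entries of $\mathbf A$, $$\mathbf C_{\mathbf q}=\rho_{\mathrm u}(1-\rho_{\mathrm u})\,\mathrm{diag}\big(\mathbf\Psi\mathbf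 C_{\mathbf h}\mathbf\Psi^{\mathrm H}+\sigma_{\mathrm u}^2\mathbf I_T\otimes\mathbf W^{\mathrm H}\mathbf W\big),$$ $$\mathbf C_{\mathbf y}=(1-\rho_{\mathrm u})^2\mathbf\Psi\mathbf C_{\mathbf h}\mathbf\Psi^{\mathrm H}+(1-\rho_{\mathrm u})^2\sigma_{\mathrm u}^2\mathbf I_T\otimes\mathbf W^{\mathrm H}\mathbf W+\mathbf C_{\mathbf q},\qquad \mathbf C_{\mathbf h\hat{\mathbf y}}=(1-\rho_{\mathrm u})\mathbf C_{\mathbf h}\mathbf\Psi^{\mathrm H}.$$ For $\sigma>0$ (the codebook parameter, i.e. the standard deviation of the i.i.d. compression noise), the covariance of the LMMSE channel estimation error and the fronthaul rate are $$\mathbf C_{\tilde{\mathbf h}}(\sigma)=\mathbf C_{\mathbf h}-\mathbf C_{\mathbf h\hat{\mathbf y}}\big(\mathbf C_{\mathbf y}+\sigma^2\mathbf I_{RT}\big)^{-1}\mathbf C_{\mathbf h\hat{\mathbf y}}^{\mathrm H},\qquad C(\sigma)=\log_2\det\Big(\mathbf I_{RT}+\frac{1}{\sigma^2}\mathbf C_{\mathbf y}\Big).$$ *)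

(* Defs.v *)
From mathcomp Require Import all_boot all_order all_algebra.
From mathcomp Require Import sesquilinear spectral.
From mathcomp Require Import complex mxtens.
From mathcomp Require Import reals exp.

Set Implicit Arguments.
Unset Strict Implicit.
Unset Printing Implicit Defensive.

Import Order.TTheory GRing.Theory Num.Theory.

Local Open Scope ring_scope.
Local Open Scope complex_scope.
Local Open Scope sesquilinear_scope.

Section MatrixNotions.
Variable (F : realType).

(* In F[i], [0 <= z] says that z is real and nonnegative. *)
Definition psdmx n (A : 'M[F[i]]_n) : Prop :=
  forall v : 'cV[F[i]]_n, 0 <= (v^t* *m A *m v) 0 0.

(* [mxtens_index (k, a)] is the position k * N + a, i.e. entry a of block k. *)
Definition block_diagonal K N (A : 'M[F[i]]_(K * N)) : Prop :=
  forall (k l : 'I_K) (a b : 'I_N), k != l ->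
    A (mxtens_index (k, a)) (mxtens_index (l, b)) = 0.

Definition diag_part n (A : 'M[F[i]]_n) : 'M[F[i]]_n :=
  diag_mx (\row_j A j j).

Definition log2 (x : F) : F := ln x / ln 2%:R.

End MatrixNotions.

Section Model.
Variables (F : realType) (N R K T : nat).
Variables (rho sigma_u : F).
Variables (W : 'M[F[i]]_(N, R)) (X : 'M[F[i]]_(T, K)).
Variable C_h : 'M[F[i]]_(K * N).

Definition Psi : 'M[F[i]]_(T * R, K * N) := tensmx (map_mx Num.conj X) (W^t*).

Definition signal_cov : 'M[F[i]]_(T * R) := Psi *m C_h *m Psi^t*.

Definition noise_cov : 'M[F[i]]_(T * R) :=
  (sigma_u ^+ 2)%:C *: tensmx (1%:M : 'M_T) (W^t* *m W).

Definition C_q : 'M[F[i]]_(T * R) :=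
  (rho * (1 - rho))%:C *: diag_part (signal_cov + noise_cov).

Definition C_y : 'M[F[i]]_(T * R) :=
  ((1 - rho) ^+ 2)%:C *: signal_cov + ((1 - rho) ^+ 2)%:C *: noise_cov + C_q.

Definition C_hy : 'M[F[i]]_(K * N, T * R) :=
  (1 - rho)%:C *: (C_h *m Psi^t*).

Definition C_err (sigma : F) : 'M[F[i]]_(K * N) :=
  C_h - C_hy *m invmx (C_y + ((sigma ^+ 2)%:C)%:M) *m C_hy^t*.

(* The determinant is that of a Hermitian matrix, hence real; [complex.Re]
   only transports it from F[i] to F. *)
Definition fronthaul_rate (sigma : F) : F :=
  log2 (complex.Re (\det (1%:M + (sigma ^- 2)%:C *: C_y))).

End Model.

(* Main.v *)
(** Diagonalise the positive semidefinite matrix C_y in an orthonormal basis,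
    with eigenvalues l_i >= 0.  The determinant in the rate is
    prod_i (1 + l_i / s^2), and the trace of the error covariance is
    tr C_h - sum_i c_i / (l_i + s^2), where c_i >= 0 is the squared norm of the
    i-th column of C_hy in that basis.  The unit-modulus entries of W put
    the positive number sigma_u^2 N on the diagonal of the noise covariance, so
    some l_i is positive.  Hence the rate strictly decreases in s, the error
    increases in s, and the intermediate value theorem for the polynomial
    prod_i (1 + l_i t), with t = 1 / s^2, gives the s that meets the
    constraint with equality. *)
Require Import Defs.
From mathcomp Require Import all_boot all_order all_algebra.
From mathcomp Require Import sesquilinear spectral.
From mathcomp Require Import complex mxtens.
From mathcomp Require Import reals sequences exp.

Set Implicit Arguments.
Unset Strict Implicit.
Unset Printing Implicit Defensive.

Import Order.TTheory GRing.Theory Num.Theory.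

Local Open Scope ring_scope.
Local Open Scope complex_scope.
Local Open Scope sesquilinear_scope.

(** * Conjugate transposes and Gram matrices *)

Section ConjugateTranspose.
Variable C : numClosedFieldType.

Lemma trCmx_mul m n p (A : 'M[C]_(m, n)) (B : 'M[C]_(n, p)) :
  (A *m B)^t* = B^t* *m A^t*.
Proof. by rewrite trmx_mul map_mxM. Qed.

Lemma trCmxD m n (A B : 'M[C]_(m, n)) : (A + B)^t* = A^t* + B^t*.
Proof. by apply/matrixP => i j; rewrite !mxE rmorphD. Qed.

Lemma trCmx_gram m n (B : 'M[C]_(m, n)) : (B^t* *m B)^t* = B^t* *m B.
Proof. by rewrite trCmx_mul trmxCK. Qed.

Lemma mulmx_trC_diag_ge0 m n (B : 'M[C]_(m, n)) i : 0 <= (B^t* *m B) i i.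
Proof.
rewrite mxE; apply: sumr_ge0 => k _.
by rewrite !mxE mulrC mul_conjC_ge0.
Qed.

End ConjugateTranspose.

(** * Positive semidefinite matrices and their spectral calculus *)

Section PositiveSemidefinite.
Variable F : realType.
Implicit Types (a s t : F).

Lemma realC_ge0 a : 0 <= a -> 0 <= a%:C.
Proof. by rewrite -lecR. Qed.

Lemma trCmxZ_realC m n a (A : 'M[F[i]]_(m, n)) :
  (a%:C *: A)^t* = a%:C *: A^t*.
Proof.
have ar : a%:C \is Num.real by apply/Creal_ImP; rewrite -complexIm.
apply/matrixP => i j; rewrite !mxE rmorphM /=; congr (_ * _); exact/CrealP.
Qed.

Lemma psdmxD n (A B : 'M[F[i]]_n) : psdmx A -> psdmx B -> psdmx (A + B).
Proof.
by move=> pA pB v; rewrite mulmxDr mulmxDl mxE addr_ge0 ?pA ?pB.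
Qed.

Lemma psdmxZ n (z : F[i]) (A : 'M[F[i]]_n) :
  0 <= z -> psdmx A -> psdmx (z *: A).
Proof. by move=> z0 pA v; rewrite -scalemxAr -scalemxAl mxE mulr_ge0 ?pA. Qed.

Lemma psdmx_congr m n (B : 'M[F[i]]_(m, n)) (A : 'M[F[i]]_n) :
  psdmx A -> psdmx (B *m A *m B^t*).
Proof.
by move=> pA v; move: (pA (B^t* *m v)); rewrite trCmx_mul trmxCK !mulmxA.
Qed.

Lemma psdmx_gram m n (B : 'M[F[i]]_(m, n)) : psdmx (B^t* *m B).
Proof.
move=> v; rewrite mulmxA -mulmxA -trCmx_mul; exact: mulmx_trC_diag_ge0.
Qed.

Lemma psdmx_diag_ge0 n (A : 'M[F[i]]_n) i : psdmx A -> 0 <= A i i.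
Proof.
move=> /(_ (delta_mx i 0)); rewrite trmx_delta map_delta_mx /=.
by rewrite -rowE -colE !mxE.
Qed.

Lemma psdmx_diag_mx n (d : 'rV[F[i]]_n) :
  (forall i, 0 <= d 0 i) -> psdmx (diag_mx d).
Proof.
move=> d0 v; rewrite mul_mx_diag mxE; apply: sumr_ge0 => i _.
by rewrite !mxE mulrAC mulr_ge0 // mulrC mul_conjC_ge0.
Qed.

Lemma psdmx_diag_part n (A : 'M[F[i]]_n) : psdmx A -> psdmx (diag_part A).
Proof. by move=> pA; apply: psdmx_diag_mx => i; rewrite mxE psdmx_diag_ge0. Qed.

Lemma trCmx_diag_part n (A : 'M[F[i]]_n) :
  A^t* = A -> (diag_part A)^t* = diag_part A.
Proof.
move=> hA; rewrite /diag_part tr_diag_mx map_diag_mx; congr diag_mx.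
by apply/rowP => j; rewrite !mxE -[in RHS]hA !mxE.
Qed.

(** The spectral theorem for normal matrices yields eigenvalues in [F[i]]. Positivity makes them
    real and nonnegative, so they can be carried by a function into [F], where order and real
    analysis are available. *)
Lemma psdmx_spectral n (A : 'M[F[i]]_n) : A \is hermsymmx -> psdmx A ->
  exists (U : 'M[F[i]]_n) (l : 'I_n -> F),
    [/\ U \is unitarymx, forall i, 0 <= l i &
        A = U^t* *m diag_mx (\row_i (l i)%:C) *m U].
Proof.
move=> hA pA; have := hermitian_normalmx hA => /orthomx_spectralP.
have Uu := spectral_unitarymx A.
set U := spectralmx A in Uu *; set d := spectral_diag A => eA.
rewrite invmx_unitary // in eA.
have d0 i : 0 <= d 0 i.
  have /unitarymxP UU := Uu.
  (* The [i]-th eigenvalue is the [i]-th diagonal entry of [U *m A *m U^t*]. *)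
  have := psdmx_diag_ge0 i (psdmx_congr U pA).
  by rewrite eA !mulmxA UU mul1mx -mulmxA UU mulmx1 mxE eqxx.
have dE i : (complex.Re (d 0 i))%:C = d 0 i.
  by rewrite RRe_real // ger0_real.
have dRe : \row_i (complex.Re (d 0 i))%:C = d by apply/rowP => i; rewrite mxE dE.
exists U, (fun i => complex.Re (d 0 i)); split; first exact: Uu.
  by move=> i; rewrite -lecR dE.
by rewrite dRe.
Qed.

Lemma det_spectral n (U : 'M[F[i]]_n) (l : 'I_n -> F) t : U \is unitarymx ->
  \det (1%:M + t%:C *: (U^t* *m diag_mx (\row_i (l i)%:C) *m U)) =
  (\prod_i (1 + t * l i))%:C.
Proof.
move=> Uu; have UU : U^t* *m U = 1%:M.
  by rewrite -invmx_unitary // mulVmx // unitarymx_unit.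
have -> : 1%:M + t%:C *: (U^t* *m diag_mx (\row_i (l i)%:C) *m U) =
    U^t* *m diag_mx (\row_i (1 + t * l i)%:C) *m U.
  have -> : diag_mx (\row_i (1 + t * l i)%:C) =
      1%:M + t%:C *: diag_mx (\row_i (l i)%:C) :> 'M[F[i]]_n.
    apply/matrixP => i j; rewrite !mxE rmorphD rmorph1 rmorphM /=.
    by case: eqP => _; rewrite ?mulr1n ?mulr0n ?mulr0 ?addr0.
  by rewrite mulmxDr mulmxDl mulmx1 UU -scalemxAr -scalemxAl.
(* The determinants of [U^t*] and [U] are brought together and cancel. *)
rewrite !det_mulmx mulrAC -det_mulmx UU det1 mul1r det_diag rmorph_prod.
by apply: eq_bigr => i _; rewrite mxE.
Qed.

Lemma invmx_spectral n (U : 'M[F[i]]_n) (l : 'I_n -> F) s : U \is unitarymx ->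
  (forall i, 0 < l i + s) ->
  invmx (U^t* *m diag_mx (\row_i (l i)%:C) *m U + s%:C%:M) =
  U^t* *m diag_mx (\row_i ((l i + s)^-1)%:C) *m U.
Proof.
move=> Uu ls0; have UU : U^t* *m U = 1%:M.
  by rewrite -invmx_unitary // mulVmx // unitarymx_unit.
set L := _ + _; set M := RHS; have LM : L *m M = 1%:M.
  have -> : L = U^t* *m diag_mx (\row_i (l i + s)%:C) *m U.
    have -> : diag_mx (\row_i (l i + s)%:C) =
        diag_mx (\row_i (l i)%:C) + s%:C%:M :> 'M[F[i]]_n.
      by apply/matrixP => i j; rewrite !mxE rmorphD /= mulrnDl.
    rewrite mulmxDr mulmxDl; congr (_ + _).
    by rewrite mul_mx_scalar -scalemxAl UU scalemx1.
  rewrite /M !mulmxA mulmxtVK // -[_ *m diag_mx _ *m diag_mx _]mulmxA.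
  rewrite mulmx_diag; set D := diag_mx _.
  suff -> : D = 1%:M by rewrite mulmx1.
  apply/matrixP => i j; rewrite !mxE -rmorphM /= divff ?rmorph1 //.
  by rewrite gt_eqF.
(* For square matrices a right inverse is the inverse, so checking [L *m M = 1%:M] was enough. *)
have /mulmx1_unit[uL _] := LM.
by rewrite -[RHS]mul1mx -(mulVmx uL) -mulmxA LM mulmx1.
Qed.

(** Cyclicity of the trace moves [V^t*] to the front, with [V := B *m U^t*]. The weights are then
    the squared norms of the columns of [V], hence nonnegative. *)
Lemma trace_spectral m n (B : 'M[F[i]]_(m, n)) (U : 'M[F[i]]_n)
    (l : 'I_n -> F) :
  \tr (B *m (U^t* *m diag_mx (\row_i (l i)%:C) *m U) *m B^t*) =
  \sum_i (l i)%:C * (((B *m U^t*)^t* *m (B *m U^t*)) i i).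
Proof.
set V := B *m U^t*.
have -> : B *m (U^t* *m diag_mx (\row_i (l i)%:C) *m U) *m B^t* =
    V *m diag_mx (\row_i (l i)%:C) *m V^t*.
  by rewrite /V trCmx_mul trmxCK !mulmxA.
rewrite mxtrace_mulC mulmxA mul_mx_diag; apply: eq_bigr => i _.
by rewrite !mxE mulrC.
Qed.

End PositiveSemidefinite.

(** * Monotonicity and range of a product of affine factors *)

Section ProductEquation.
Variables (F : rcfType) (n : nat) (l : 'I_n -> F).
Hypotheses (l_ge0 : forall i, 0 <= l i) (l_gt0 : exists i, 0 < l i).

Let p (t : F) := \prod_i (1 + t * l i).

Lemma prod_affine_gt0 t : 0 <= t -> 0 < p t.
Proof. by move=> t0; apply: prodr_gt0 => i _; rewrite ltr_wpDr ?mulr_ge0. Qed.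

Lemma prod_affine_ltr t u : 0 <= t -> t < u -> p t < p u.
Proof.
move=> t0 tu; have [j lj] := l_gt0; have u0 := le_trans t0 (ltW tu).
rewrite /p (bigD1 j) //= [ltRHS](bigD1 j) //=.
have Pt0 : 0 < \prod_(i < n | i != j) (1 + t * l i).
  by apply: prodr_gt0 => i _; rewrite ltr_wpDr ?mulr_ge0.
(* Raise factor [j] first, which is strict because [l j] is positive, and then the other factors,
   which is only weak. *)
apply: (@lt_le_trans _ _ ((1 + u * l j) * \prod_(i < n | i != j) (1 + t * l i))).
  by rewrite ltr_pM2r // ltrD2l ltr_pM2r.
rewrite ler_wpM2l ?addr_ge0 ?mulr_ge0 //; apply: ler_prod => i _.
by rewrite addr_ge0 ?mulr_ge0 //= lerD2l ler_wpM2r // ltW.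
Qed.

Lemma prod_affine_exists v : 1 < v -> exists2 t, 0 < t & p t = v.
Proof.
move=> v1; have [j lj] := l_gt0; have v0 : 0 < v by exact: lt_trans v1.
pose q : {poly F} := \prod_i (1 + l i *: 'X) - v%:P.
have qE t : q.[t] = p t - v.
  rewrite !hornerE horner_prod; congr (_ - _); apply: eq_bigr => i _.
  by rewrite !hornerE mulrC.
have p0 : p 0 = 1 by apply: big1 => i _; rewrite mul0r addr0.
(* At this point factor [j] equals [1 + v] and every other factor is at least 1, so [v / l j] is a
   right end point for the intermediate value theorem. *)
have pv : v <= p (v / l j).
  rewrite /p (bigD1 j) //= divfK ?gt_eqF //.
  rewrite -[leLHS]mulr1 ler_pM ?lerDr ?(ltW v0) //.
  elim/big_ind: _ => // [x y x1 y1|i _]; first by rewrite mulr_ege1.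
  by rewrite lerDl mulr_ge0 ?divr_ge0 // ltW.
have [||t /andP[t0 _]] := @poly_ivt F q 0 (v / l j).
- by rewrite divr_ge0 // ltW.
- by rewrite !qE p0 subr_le0 subr_ge0 (ltW v1) pv.
rewrite rootE qE subr_eq0 => /eqP pt; exists t => //.
rewrite lt_neqAle t0 andbT; apply/eqP => t0'.
by move: v1; rewrite -pt -t0' p0 ltxx.
Qed.

End ProductEquation.

(** * Rate against error for a general covariance *)

Section RateErrorTradeoff.
Variable F : realType.

(** [B] and [C] can be arbitrary: [\tr C] cancels when two errors are compared, even if it is not
    real, and [B] enters only through nonnegative weights. *)
Lemma rate_error_optimum m n (A : 'M[F[i]]_n) (B : 'M[F[i]]_(m, n))
    (C : 'M[F[i]]_m) (c : F) :
  A \is hermsymmx -> psdmx A -> A != 0 -> 0 < c ->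
  let rate s := log2 (complex.Re (\det (1%:M + (s ^- 2)%:C *: A))) in
  let err s := \tr (C - B *m invmx (A + ((s ^+ 2)%:C)%:M) *m B^t*) in
  exists sigma : F,
    [/\ 0 < sigma, rate sigma = c,
        forall s, 0 < s -> rate s = c -> s = sigma
      & forall s, 0 < s -> rate s <= c -> err sigma <= err s].
Proof.
move=> hA pA A0 c0 rate err.
have [U [l [Uu l0 eA]]] := psdmx_spectral hA pA.
have l_gt0 : exists i, 0 < l i.
  (* If all eigenvalues vanished, the spectral decomposition would give [A = 0]. *)
  apply/existsP; apply: contraNT A0; rewrite negb_exists => /forallP nl.
  have l_eq0 : \row_i (l i)%:C = 0.
    apply/rowP => i; rewrite !mxE.
    by have := nl i; rewrite lt_def l0 andbT negbK => /eqP ->.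
  by rewrite eA l_eq0 raddf0 mulmx0 mul0mx.
pose p (t : F) := \prod_i (1 + t * l i).
have inv2_gt0 s : 0 < s -> 0 < s ^- 2 :> F.
  by move=> s0; rewrite invr_gt0 exprn_gt0.
have ln2_gt0 : 0 < ln 2 :> F by rewrite ln_gt0 // ltr1n.
have rateE s : rate s = ln (p (s ^- 2)) / ln 2.
  by rewrite /rate {1}eA det_spectral.
have rate_lt s s' : 0 < s -> s < s' -> rate s' < rate s.
  move=> s0 ss'; have s'0 := lt_trans s0 ss'.
  rewrite !rateE ltr_pM2r ?invr_gt0 // ltr_ln ?posrE;
    try by apply: prod_affine_gt0 => //; rewrite ltW ?inv2_gt0.
  apply: prod_affine_ltr => //; first by rewrite ltW ?inv2_gt0.
  by rewrite ltf_pV2 ?posrE ?exprn_gt0 // ltr_pXn2r // ?nnegrE ltW.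
have err_le s s' : 0 < s -> s <= s' -> err s <= err s'.
  move=> s0 ss'; have s'0 := lt_le_trans s0 ss'.
  have ls u i : 0 < u -> 0 < l i + u ^+ 2.
    by move=> u0; rewrite ltr_wpDl ?exprn_gt0.
  have errE u : 0 < u -> err u = \tr C -
      \sum_i ((l i + u ^+ 2)^-1)%:C * (((B *m U^t*)^t* *m (B *m U^t*)) i i).
    move=> u0; rewrite /err raddfB /=; congr (_ - _).
    rewrite -trace_spectral -invmx_spectral -?eA // => i; exact: ls.
  rewrite errE // errE // lerD2l lerN2; apply: ler_sum => i _.
  rewrite ler_wpM2r ?mulmx_trC_diag_ge0 // lecR lef_pV2 ?posrE ?ls //.
  by rewrite lerD2l ler_pXn2r // nnegrE ltW.
(* The target is 2 to the power [c], which exceeds 1 because [c] is positive. *)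
have [|t t0 pt] := @prod_affine_exists F n l l0 l_gt0 (expR (c * ln 2)).
  by rewrite expR_gt1 mulr_gt0.
(* Chosen so that [sigma ^- 2 = t]. *)
pose sigma := Num.sqrt t^-1.
have sigma0 : 0 < sigma by rewrite sqrtr_gt0 invr_gt0.
have rate_sigma : rate sigma = c.
  rewrite rateE /sigma sqr_sqrtr ?invr_ge0 ?ltW // invrK /p pt expRK.
  by rewrite mulfK // gt_eqF.
exists sigma; split; [exact: sigma0 | exact: rate_sigma | |] => s s0 rs.
  have [ss'|ss'|//] := ltgtP s sigma.
    by have := rate_lt _ _ s0 ss'; rewrite rs rate_sigma ltxx.
  by have := rate_lt _ _ sigma0 ss'; rewrite rs rate_sigma ltxx.
(* A noise level below [sigma] would have rate above [c], so every feasible [s] is at least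
   [sigma]. *)
apply: err_le => //; rewrite leNgt; apply/negP => /(rate_lt _ _ s0).
by rewrite rate_sigma ltNge rs.
Qed.

End RateErrorTradeoff.

(** * The covariance [C_y] is Hermitian, positive semidefinite and nonzero *)

Section ReceivedCovariance.
Variables (F : realType) (N R K T : nat) (rho sigma_u : F).
Variables (W : 'M[F[i]]_(N, R)) (X : 'M[F[i]]_(T, K)).
Variable C_h : 'M[F[i]]_(K * N).
Hypotheses (rho_ge0 : 0 <= rho) (rho_lt1 : rho < 1).
Hypotheses (C_h_herm : C_h^t* = C_h) (C_h_psd : psdmx C_h).

Let S := signal_cov W X C_h.
Let Z := noise_cov T sigma_u W.

(** The mixed-product rule for Kronecker products exhibits a Gram matrix, from which symmetry and
    positivity both follow. *)
Lemma noise_cov_gram :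
  Z = (sigma_u ^+ 2)%:C *:
      ((tensmx (1%:M : 'M_T) W)^t* *m tensmx (1%:M : 'M_T) W).
Proof.
rewrite /Z /noise_cov trmx_tens map_mxT tensmx_mul.
by rewrite trmx1 map_mx1 mulmx1.
Qed.

Lemma trCmx_noise_cov : Z^t* = Z.
Proof. by rewrite noise_cov_gram trCmxZ_realC trCmx_gram. Qed.

Lemma trCmx_signal_cov : S^t* = S.
Proof. by rewrite /S /signal_cov !trCmx_mul trmxCK C_h_herm mulmxA. Qed.

Lemma psdmx_noise_cov : psdmx Z.
Proof.
rewrite noise_cov_gram; apply: psdmxZ; last exact: psdmx_gram.
by rewrite realC_ge0 ?sqr_ge0.
Qed.

Lemma psdmx_signal_cov : psdmx S.
Proof. exact: psdmx_congr. Qed.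

Lemma C_yE : C_y rho sigma_u W X C_h =
  ((1 - rho) ^+ 2)%:C *: (S + Z) +
  (rho * (1 - rho))%:C *: diag_part (S + Z).
Proof. by rewrite /C_y /C_q -scalerDr. Qed.

Lemma hermsymmx_C_y : C_y rho sigma_u W X C_h \is hermsymmx.
Proof.
apply/is_hermitianmxP; rewrite expr0 scale1r C_yE.
have : (S + Z)^t* = S + Z by rewrite trCmxD trCmx_signal_cov trCmx_noise_cov.
move: (S + Z) => A hA.
by rewrite trCmxD !trCmxZ_realC (trCmx_diag_part hA) hA.
Qed.

Lemma psdmx_C_y : psdmx (C_y rho sigma_u W X C_h).
Proof.
have pSZ := psdmxD psdmx_signal_cov psdmx_noise_cov.
rewrite C_yE; move: (S + Z) pSZ => A pA.
apply: psdmxD; apply: psdmxZ; [|exact: pA| |exact: psdmx_diag_part].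
- by rewrite realC_ge0 ?sqr_ge0.
- by rewrite realC_ge0 // mulr_ge0 // subr_ge0 ltW.
Qed.

Lemma noise_cov_diag k : (forall a r, `|W a r| = 1) ->
  Z k k = (sigma_u ^+ 2)%:C * N%:R.
Proof.
move=> hW; case: (mxtens_indexP k) => t r.
rewrite /Z /noise_cov mxE tensmxE !mxE eqxx mul1r.
congr (_ * _); rewrite -[in RHS](card_ord N) -sumr_const.
by apply: eq_bigr => a _; rewrite !mxE mulrC -normCK hW expr1n.
Qed.

(** On the diagonal the quantization term has the same shape as the rest, and [(1 - rho) ^+ 2 + rho
    * (1 - rho) = 1 - rho]. *)
Lemma C_y_diag k : C_y rho sigma_u W X C_h k k = (1 - rho)%:C * (S + Z) k k.
Proof.
rewrite C_yE; move: (S + Z) => A.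
rewrite !mxE eqxx mulr1n -mulrDl -rmorphD; congr (_%:C * _).
by rewrite expr2 -mulrDl subrK mul1r.
Qed.

(** One positive diagonal entry suffices: the signal contributes a nonnegative amount there and the
    noise a positive one. *)
Lemma C_y_neq0 : (0 < N)%N -> (0 < R)%N -> (0 < T)%N -> 0 < sigma_u ^+ 2 ->
  (forall a r, `|W a r| = 1) -> C_y rho sigma_u W X C_h != 0.
Proof.
move=> N0 R0 T0 su0 hW.
have k : 'I_(T * R) := mxtens_index (Ordinal T0, Ordinal R0).
have Sk : 0 <= S k k := psdmx_diag_ge0 k psdmx_signal_cov.
have Zk : 0 < Z k k by rewrite noise_cov_diag // mulr_gt0 ?ltr0n // ltcR.
have : 0 < C_y rho sigma_u W X C_h k k.
  by rewrite C_y_diag mulr_gt0 ?ltcR ?subr_gt0 // mxE ltr_wpDl.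
by apply: contraTneq => ->; rewrite mxE ltxx.
Qed.

End ReceivedCovariance.

Theorem mainTheorem2 (F : realType) (N R K T : nat)
    (hN : (0 < N)%N) (hR : (0 < R)%N) (hK : (0 < K)%N)
    (hT : (0 < T)%N) (hKT : (K <= T)%N)
    (rho sigma_u P_u C_u : F)
    (hrho0 : 0 <= rho) (hrho1 : rho < 1)
    (hsigma_u : 0 < sigma_u ^+ 2) (hP_u : 0 < P_u) (hC_u : 0 < C_u)
    (W : 'M[F[i]]_(N, R)) (hW : forall a r, `|W a r| = 1)
    (X : 'M[F[i]]_(T, K)) (hX : X^t* *m X = ((T%:R * P_u)%:C)%:M)
    (C_h : 'M[F[i]]_(K * N))
    (hC_h_block : block_diagonal C_h)
    (hC_h_herm : C_h \is hermsymmx)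
    (hC_h_psd : psdmx C_h) :
  let rate := fronthaul_rate rho sigma_u W X C_h in
  let objective := fun sigma : F => \tr (C_err rho sigma_u W X C_h sigma) in
  exists sigma : F,
    [/\ 0 < sigma,
        rate sigma = T%:R * C_u,
        forall s : F, 0 < s -> rate s = T%:R * C_u -> s = sigma
      & forall s : F, 0 < s -> rate s <= T%:R * C_u ->
          objective sigma <= objective s].
Proof.
move=> rate objective.
have C_hE : C_h^t* = C_h.
  by move/is_hermitianmxP: hC_h_herm; rewrite expr0 scale1r => /esym.
apply: (rate_error_optimum (C_hy rho W X C_h) C_h).
- exact: hermsymmx_C_y.
- exact: psdmx_C_y.
- exact: C_y_neq0.
- by rewrite mulr_gt0 ?ltr0n.
Qed.
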